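(* Suppose $U\in\mathcal{CU}_\mu(\mathbb C^J)$ and let $F:\{0,\dots,J-1\}\to\{0,\dots,J-1\}$ be an automorphism. Then $\mathfrak h(U_F^{-1}UU_F)=\mathfrak h(U)$.
   Context: Let $J\ge1$ and $\mu_0,\dots,\mu_{J-1}>0$ be the first $J$ terms of a sequence $(\mu_j)_{j\in\mathbb N_0}$ of positive numbers with sum $1$ (or positive numbers themselves summing to $1$). An automorphism is a bijection $F$ of $\{0,\dots,J-1\}$ preserving the measure, i.e. $\mu_{F(j)}=\mu_j$ for all $j$; its Koopman operator is $U_F:x\mapsto x\circ F$, $(U_Fx)_j=x_{F(j)}$. $\mathbb C^J$ carries $\langle x,y\rangle=\sum_{j=0}^{J-1}\mu_jx_j\overline{y_j}$, $\|x\|=\sqrt{\langle x,x\rangle}$, and $\mathcal{CU}_\mu(\mathbb C^J)$ is the set of linear operators $U$ on $\mathbb C^J$ with $\|Ux\|\le\|x\|$ for all $x$. Let $(Ux)_j=\sum_kU_{jk}x_k$ and let $b(U)=\mathbf B$ be the $J\times J$ matrix $\mathbf B_{jk}=\frac{\mu_j}{\mu_k}|U_{jk}|^2$. $\mathcal P_{\mathrm{Ker}(\mathbf B-I)}$ is the projection of $\mathbb C^J$ onto $\mathrm{Ker}(\mathbf B-I)$ along $\mathrm{Im}(\mathbf B-I)$ (these are complementary), and $\mathcal P^T$ its transpose. With $\mu=(\mu_0,\dots,\mu_{J-1})$, $e=(1,\dots,1)$ and $0\log0=0$, the entropy of $U$ is $$\mathfrak h(U)=-\sum_{j,k=0}^{J-1}\big(\mathcal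 P^T_{\mathrm{Ker}(\mathbf B-I)}e\big)_j\,\mathbf B_{jk}\,\big(\mathcal P_{\mathrm{Ker}(\mathbf B-I)}\mu\big)_k\log\mathbf B_{jk}.$$ *)

(* Defs.v *)
From mathcomp Require Import all_boot all_order all_algebra.
From mathcomp Require Import complex.
From mathcomp Require Import classical_sets reals topology normedtype sequences exp.

Set Implicit Arguments.
Unset Strict Implicit.
Unset Printing Implicit Defensive.

Import Order.TTheory GRing.Theory Num.Theory.
Import numFieldNormedType.Exports.

Local Open Scope classical_set_scope.
Local Open Scope ring_scope.
Local Open Scope complex_scope.

Definition is_weight (R : realType) (J : nat) (mu : 'I_J -> R) : Prop :=
  (exists nu : nat -> R,
     [/\ forall n, 0 < nu n,
         series nu @ \oo --> (1 : R)
       & forall j : 'I_J, mu j = nu j])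
  \/ ((forall j, 0 < mu j) /\ \sum_j mu j = 1).

Definition is_automorphism (R : realType) (J : nat) (mu : 'I_J -> R)
    (F : 'I_J -> 'I_J) : Prop :=
  bijective F /\ forall j, mu (F j) = mu j.

Section Entropy.
Variables (R : realType) (J : nat).
Implicit Types (mu : 'I_J -> R) (U : 'M[R[i]]_J) (x y : 'cV[R[i]]_J).

(* Operators on C^J are identified with their matrices, acting on column
   vectors on the left. *)

Definition koopman (F : 'I_J -> 'I_J) : 'M[R[i]]_J :=
  \matrix_(j, k) (k == F j)%:R.

Lemma koopmanE F x j : (koopman F *m x) j 0 = x (F j) 0.
Proof.
rewrite mxE (bigD1 (F j)) //= mxE eqxx mul1r big1 ?addr0 // => k /negPf kF.
by rewrite mxE kF mul0r.
Qed.

Lemma koopman_unit F : bijective F -> koopman F \in unitmx.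
Proof.
move=> [G FK GK].
suff /mulmx1_unit[] : koopman F *m koopman G = 1%:M by [].
apply/matrixP=> j k; rewrite mxE (bigD1 (F j)) //= !mxE eqxx mul1r FK.
rewrite big1 ?addr0 1?eq_sym // => i /negPf iF.
by rewrite !mxE iF mul0r.
Qed.

Definition inner mu x y : R[i] := \sum_j (mu j)%:C * x j 0 * (y j 0)^*.

Definition mu_norm mu x : R[i] := sqrtC (inner mu x x).

Definition contraction mu U : Prop :=
  forall x, mu_norm mu (U *m x) <= mu_norm mu x.

Definition b_mx mu U : 'M[R]_J :=
  \matrix_(j, k) (mu j / mu k * Normc.normc (U j k) ^+ 2).

(* The projection of column vectors onto Ker A along Im A. Since MathComp's
   kermx, row spaces and proj_mx refer to row vectors acted on from the right,
   all data are transposed. It is meaningful when Ker A and Im A are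
   complementary; see colker_projK and colker_proj0. *)
Definition colker_proj (A : 'M[R[i]]_J) : 'M[R[i]]_J :=
  (proj_mx (kermx A^T) A^T)^T.

Lemma colker_projK (A : 'M[R[i]]_J) x :
  (kermx A^T :&: A^T = 0)%MS -> A *m x = 0 -> colker_proj A *m x = x.
Proof.
move=> dxA Ax0; apply: trmx_inj; rewrite trmx_mul trmxK proj_mx_id //.
by apply/sub_kermxP; rewrite -trmx_mul Ax0 trmx0.
Qed.

Lemma colker_proj0 (A : 'M[R[i]]_J) x :
  (kermx A^T :&: A^T = 0)%MS -> colker_proj A *m (A *m x) = 0.
Proof.
move=> dxA; apply: trmx_inj; rewrite trmx_mul trmxK proj_mx_0 ?trmx0 //.
by rewrite trmx_mul submxMl.
Qed.

Definition ker_proj mu U : 'M[R[i]]_J :=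
  colker_proj (map_mx (real_complex R) (b_mx mu U) - 1%:M).

(* The library's ln satisfies ln 0 = 0, so the terms with a zero entry of the
   matrix vanish, as 0 log 0 = 0 requires. *)
Definition entropy mu U : R[i] :=
  - \sum_(j < J) \sum_(k < J)
      ((ker_proj mu U)^T *m const_mx 1 : 'cV_J) j 0
      * (b_mx mu U j k)%:C
      * (ker_proj mu U *m \col_i (mu i)%:C) k 0
      * (ln (b_mx mu U j k))%:C.

End Entropy.

Arguments koopman R {J} F.

(* Main.v *)
Require Import Defs.
From mathcomp Require Import all_boot all_order all_algebra.
From mathcomp Require Import complex.
From mathcomp Require Import reals.

Local Open Scope ring_scope.

Import Order.TTheory GRing.Theory Num.Theory.

(** Conjugating [U] by [U_F] relabels the indices of [U] by the inverse of [F],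
    and, since [F] preserves [mu], it relabels those of [B] in the same way.
    The entropy is invariant under relabelling as soon as the projection onto
    [Ker (B - I)] along [Im (B - I)] is determined by these two subspaces, that
    is, as soon as they are complementary. Testing the contraction [U] on basis
    vectors shows that the columns of [B] have sums at most [1], so [B] contracts
    the l^1 norm. If [y = (B - I) x] and [B y = y], then [B^n x = x + n y] stays
    bounded, whence [y = 0]. *)

Lemma weight_gt0 {R : realType} {J : nat} {mu : 'I_J -> R} :
  is_weight mu -> forall j, 0 < mu j.
Proof. by case=> [[nu [nu0 _ E]] j|[]//]; rewrite E. Qed.

Section L1Norm.
Context {F : numDomainType} {n : nat}.
Implicit Types (u v : 'rV[F]_n) (M : 'M[F]_n).

Definition l1norm u : F := \sum_j `|u 0 j|.

Lemma l1norm_ge0 u : 0 <= l1norm u.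
Proof. by apply: sumr_ge0. Qed.

Lemma l1norm_le0 u : l1norm u <= 0 -> u = 0.
Proof.
move=> u_le0; have /eqP : l1norm u = 0 by apply/le_anti; rewrite u_le0 l1norm_ge0.
rewrite psumr_eq0 // => /allP u0; apply/rowP => j; rewrite mxE.
by apply/eqP; rewrite -normr_eq0; apply: u0; rewrite mem_index_enum.
Qed.

Lemma l1normB u v : l1norm (u - v) <= l1norm u + l1norm v.
Proof.
by rewrite -big_split /=; apply: ler_sum => j _; rewrite !mxE ler_normB.
Qed.

Lemma l1normMn u k : l1norm (u *+ k) = l1norm u *+ k.
Proof.
rewrite /l1norm -sumrMnl; apply: eq_bigr => j _.
by rewrite -scaler_nat mxE normrM normr_nat mulr_natl.
Qed.

(** Vectors are rows acted on from the right, so after exchanging the sums it is the row sums of [M]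
    that weigh the entries of [u]. *)
Lemma l1norm_mulmx M u : (forall i, \sum_j `|M i j| <= 1) ->
  l1norm (u *m M) <= l1norm u.
Proof.
move=> M1; apply: le_trans (_ : \sum_j \sum_i `|u 0 i| * `|M i j| <= _).
  apply: ler_sum => j _; rewrite mxE; apply: le_trans (ler_norm_sum _ _ _) _.
  by apply: ler_sum => i _; rewrite normrM.
rewrite exchange_big; apply: ler_sum => i _.
by rewrite -mulr_sumr ler_piMr.
Qed.

End L1Norm.

(** The order on [R[i]] is partial, but [0 <= a] and [0 <= b] (the case [n = 0]) make both real, so
    the Archimedean property of [R] applies to their real parts. *)
Lemma complex_mulrn_bounded {R : realType} (a b : R[i]) :
  0 <= a -> (forall n, a *+ n <= b) -> a <= 0.
Proof.
move=> a0 ab; have b0 : 0 <= b := ab 0.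
have realE (z : R[i]) : 0 <= z -> z = (complex.Re z)%:C%C.
  by move=> /ger0_real/(@RRe_real R).
move: a0 ab b0; case/boolP: (a == 0) => [/eqP->//|aN0] a0 ab b0.
have Ra : 0 < complex.Re a.
  have : 0 < a by rewrite lt_def aN0.
  by rewrite {1}(realE a a0) ltcR.
have := archi_boundP (divr_ge0 (_ : 0 <= complex.Re b) (ltW Ra)).
rewrite -lecR -realE // => /(_ b0); set n := Num.bound _ => lt_n.
have := ab n; rewrite (realE a a0) (realE b b0) -rmorphMn lecR leNgt.
by rewrite -mulr_natl -ltr_pdivrMr // lt_n.
Qed.

Lemma kermx_im_trivial {R : realType} {n : nat} (M : 'M[R[i]]_n) :
  (forall i, \sum_j `|M i j| <= 1) -> (kermx (M - 1%:M) :&: (M - 1%:M) = 0)%MS.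
Proof.
move=> M1; apply/eqP/rowV0P => y; rewrite sub_capmx => /andP[/sub_kermxP yK].
case/submxP => x yE; apply: l1norm_le0.
have yM : y *m M = y by apply/eqP; rewrite -subr_eq0 -{2}[y]mulmx1 -mulmxBr yK.
have xM : x *m M = x + y by rewrite yE mulmxBr mulmx1 addrC subrK.
(* Since [x *m M = x + y] and [y *m M = y], one application of [M] turns [x + y *+ k] into
   [x + y *+ k.+1]. *)
have bounded k : l1norm (x + y *+ k) <= l1norm x.
  elim: k => [|k]; first by rewrite mulr0n addr0.
  have ykM : y *+ k *m M = y *+ k by rewrite -scaler_nat -scalemxAl yM.
  by apply: le_trans; rewrite mulrS addrA -xM -[X in _ + X]ykM -mulmxDl l1norm_mulmx.
apply: (@complex_mulrn_bounded R _ (l1norm x + l1norm x)) => [|k].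
  exact: l1norm_ge0.
rewrite -l1normMn -[y *+ k](addrK x) [_ + x]addrC.
by apply: le_trans (l1normB _ _) _; rewrite lerD2r.
Qed.

(** By rank-nullity, trivial intersection already makes kernel and image span the whole space.
    Splitting [1%:M] along them and multiplying by [Q] leaves only the kernel part. *)
Lemma proj_mx_kermx_unique {K : fieldType} {n : nat} (A Q : 'M[K]_n) :
  (kermx A :&: A = 0)%MS -> kermx A *m Q = kermx A -> A *m Q = 0 ->
  proj_mx (kermx A) A = Q.
Proof.
move=> dxA kerQ imQ.
have full : (1%:M <= kermx A + A)%MS.
  by rewrite sub1mx /row_full mxrank_disjoint_sum // mxrank_ker subnK ?rank_leq_row.
have /submxP[v pE] := proj_mx_sub (kermx A) A 1%:M.
have /submxP[w qE] := proj_mx_sub A (kermx A) 1%:M.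
rewrite -[RHS]mul1mx -(add_proj_mx dxA full) mulmxDl pE qE.
rewrite -(mulmxA v) kerQ -(mulmxA w) imQ.
by rewrite mulmx0 addr0 -pE mul1mx.
Qed.

(** The conjugated projection fixes the kernel of [A'] and kills its image, so uniqueness identifies
    it. *)
Lemma colker_proj_conj {R : realType} {n : nat} (A P : 'M[R[i]]_n) :
  P \in unitmx -> (kermx A^T :&: A^T = 0)%MS ->
  let A' := invmx P *m A *m P in (kermx A'^T :&: A'^T = 0)%MS ->
  colker_proj A' = invmx P *m colker_proj A *m P.
Proof.
move=> uP dxA A' dxA'; apply: trmx_inj; rewrite [in LHS]/colker_proj trmxK.
apply: (proj_mx_kermx_unique _ _ dxA'); apply: trmx_inj; rewrite trmx_mul trmxK.
  (* The columns of [(kermx A'^T)^T] span the kernel of [A'], and [P] carries them into that of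
     [A]. *)
  have kerA : A *m (P *m (kermx A'^T)^T) = 0.
    have : A' *m (kermx A'^T)^T = 0.
      by apply: trmx_inj; rewrite trmx_mul trmxK mulmx_ker trmx0.
    by rewrite /A' -!mulmxA => /(congr1 (mulmx P)); rewrite mulKVmx // mulmx0.
  rewrite -!mulmxA; apply: (canLR (mulKmx uP)); apply: trmx_inj.
  rewrite trmx_mul trmxK proj_mx_id //; apply/sub_kermxP.
  by rewrite -trmx_mul kerA trmx0.
rewrite trmxK trmx0 /A' -!mulmxA mulKVmx // [colker_proj A *m _]mulmxA.
suff -> : colker_proj A *m A = 0 by rewrite mul0mx mulmx0.
by apply: trmx_inj; rewrite trmx_mul trmxK proj_mx_0 ?trmx0.
Qed.

Section Entropy.
Context {R : realType} {J : nat}.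
Implicit Types (mu : 'I_J -> R) (U : 'M[R[i]]_J).

Lemma normc_sqr (z : R[i]) : ((Normc.normc z) ^+ 2)%:C%C = z * z^*%C.
Proof. by rewrite rmorphXn /= -normCK. Qed.

Lemma b_mx_ge0 mu U j k : (forall i, 0 < mu i) -> 0 <= b_mx mu U j k.
Proof. by move=> mu0; rewrite mxE mulr_ge0 ?sqr_ge0 // divr_ge0 // ltW. Qed.

Lemma contraction_b_mx_colsum mu U : (forall j, 0 < mu j) -> contraction mu U ->
  forall k, \sum_j b_mx mu U j k <= 1.
Proof.
move=> mu0 cU k.
have innerE (x : 'cV[R[i]]_J) :
  inner mu x x = (\sum_j mu j * Normc.normc (x j 0) ^+ 2)%:C%C.
  rewrite rmorph_sum; apply: eq_bigr => j _.
  by rewrite rmorphM /= normc_sqr mulrA.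
(* The basis vector has squared norm [mu k], and its image the squared norm [mu k] times the column
   sum. *)
have := cU (delta_mx k 0); rewrite /mu_norm ler_sqrtC ?qualifE /=; last 2 first.
- by rewrite innerE ler0c sumr_ge0 // => j _; rewrite mulr_ge0 ?sqr_ge0 // ltW.
- by rewrite innerE ler0c sumr_ge0 // => j _; rewrite mulr_ge0 ?sqr_ge0 // ltW.
rewrite !innerE lecR [X in _ <= X](bigD1 k) //= [X in _ + X]big1 => [|j /negPf jk].
  rewrite mxE !eqxx Normc.normc1 expr1n mulr1 addr0 => cUk.
  rewrite -(ler_pM2l (mu0 k)) mulr1 mulr_sumr; apply: le_trans cUk.
  apply: ler_sum => j _; rewrite -colE !mxE.
  by rewrite mulrA [mu k * _]mulrC divfK // gt_eqF.
by rewrite mxE jk Normc.normc0 expr0n mulr0.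
Qed.

(** Transposition turns the column sums into the row sums that [kermx_im_trivial] bounds; the
    entries, being nonnegative, equal their moduli. *)
Lemma b_mx_ker_im_trivial mu U :
  (forall j, 0 < mu j) -> (forall k, \sum_j b_mx mu U j k <= 1) ->
  let A := map_mx (real_complex R) (b_mx mu U) - 1%:M in
  (kermx A^T :&: A^T = 0)%MS.
Proof.
move=> mu0 B1 A; rewrite /A linearB /= trmx1; apply: kermx_im_trivial => k.
rewrite -(rmorph1 (real_complex R)).
apply: le_trans (_ : (\sum_j b_mx mu U j k)%:C%C <= _); last by rewrite lecR.
rewrite rmorph_sum; apply: ler_sum => j _.
by rewrite 2!mxE ger0_norm // ler0c b_mx_ge0.
Qed.

Section Relabelling.
Variables (F G : 'I_J -> 'I_J) (FK : cancel F G) (GK : cancel G F).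

Lemma koopman_conjE (M : 'M[R[i]]_J) :
  invmx (koopman R F) *m M *m koopman R F = \matrix_(j, k) M (G j) (G k).
Proof.
have uF : koopman R F \in unitmx by apply: koopman_unit; exists G.
(* Moving the inverse to the other side avoids computing it: in each remaining product one index
   survives, [G k] on the left and [F j] on the right. *)
rewrite -mulmxA; apply: (canLR (mulKmx uF)).
apply/matrixP => j k; rewrite !mxE.
rewrite (bigD1 (G k)) //= mxE GK eqxx mulr1 big1 ?addr0; last first.
  move=> l lk; rewrite mxE; case: eqP => [kE|]; last by rewrite mulr0.
  by rewrite kE FK eqxx in lk.
rewrite (bigD1 (F j)) //= !mxE eqxx mul1r FK big1 ?addr0 // => l /negPf lj.
by rewrite !mxE lj mul0r.
Qed.

Lemma entropy_relabel mu U : (forall j, 0 < mu j) -> (forall j, mu (F j) = mu j) ->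
  contraction mu U ->
  entropy mu (invmx (koopman R F) *m U *m koopman R F) = entropy mu U.
Proof.
move=> mu0 muF cU; set U' := _ *m _.
have muG j : mu (G j) = mu j by rewrite -muF GK.
have uF : koopman R F \in unitmx by apply: koopman_unit; exists G.
have bG : bijective G by exists F.
have sumG (V : nmodType) (f : 'I_J -> V) : \sum_j f (G j) = \sum_j f j.
  by rewrite [RHS](reindex G) //; apply: onW_bij.
have bE j k : b_mx mu U' j k = b_mx mu U (G j) (G k).
  by rewrite /U' koopman_conjE !mxE !muG.
have B1 := contraction_b_mx_colsum mu U mu0 cU.
(* The bound is transported by relabelling, without showing that [U'] is a contraction. *)
have B1' k : \sum_j b_mx mu U' j k <= 1.
  rewrite (eq_bigr _ (fun j _ => bE j k)).
  by rewrite (sumG _ (fun j => b_mx mu U j (G k))).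
pose A := map_mx (real_complex R) (b_mx mu U) - 1%:M.
have AE : map_mx (real_complex R) (b_mx mu U') - 1%:M
    = invmx (koopman R F) *m A *m koopman R F.
  (* The identity matrix is unchanged by relabelling because [G] is injective. *)
  rewrite /U' !koopman_conjE; apply/matrixP => j k.
  by rewrite !mxE !muG (can_eq GK).
have pE j k : ker_proj mu U' j k = ker_proj mu U (G j) (G k).
  have dxA' := b_mx_ker_im_trivial mu U' mu0 B1'.
  have dxA := b_mx_ker_im_trivial mu U mu0 B1.
  rewrite /ker_proj; move: dxA'; rewrite /= AE => /(colker_proj_conj _ _ uF dxA) ->.
  by rewrite koopman_conjE mxE.
(* Only the entrywise relation [pE] matters from here on: both outer sums, and those hidden in the
   two matrix-vector products, are reindexed by [G]. *)
rewrite /entropy; move: (ker_proj mu U') (ker_proj mu U) pE => P' P pE.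
congr (- _); rewrite -[RHS]sumG; apply: eq_bigr => j _.
rewrite -[RHS]sumG; apply: eq_bigr => k _.
rewrite bE; congr (_ * _ * _ * _); rewrite !mxE -[RHS]sumG.
  by apply: eq_bigr => l _; rewrite !mxE pE.
by apply: eq_bigr => l _; rewrite pE !mxE muG.
Qed.

End Relabelling.
End Entropy.

Theorem lemma7p2 (R : realType) (J : nat) (HJ : (1 <= J)%N) (mu : 'I_J -> R)
    (Hmu : is_weight mu) (U : 'M[R[i]]_J) (HU : contraction mu U)
    (F : 'I_J -> 'I_J) (HF : is_automorphism mu F) :
  entropy mu (invmx (koopman R F) *m U *m koopman R F) = entropy mu U.
Proof.
case: HF => -[G FK GK] muF.
exact: entropy_relabel FK GK _ _ (weight_gt0 Hmu) muF HU.
Qed.
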